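(* Let $\alpha\in(0,1)$. The sets $\mathrm{CI}_n^\alpha=\{\theta\in\mathbb Z: J_n(\theta)\le1/\alpha\}$, $n\ge1$, form a weak $(1-\alpha)$-confidence sequence for mode. Consequently, the convex hulls $\overline{\mathrm{CI}_n^{\alpha/2}}$, $n\ge1$, form a strong $(1-\alpha)$-confidence sequence for mode.
   Context: $\mathcal P(\mathbb Z)$ is the set of probability measures on $\mathbb Z$; $f_P(n)=P(\{n\})$; $x^+=\max(x,0)$. For $\theta\in\mathbb Z$, $$\mathcal D_\theta=\{P\in\mathcal P(\mathbb Z): f_P(n-1)\le f_P(n)\text{ if }n\le\theta,\ \text{and } f_P(n)\ge f_P(n+1)\text{ if }n\ge\theta\},$$ $\mathcal D_{\mathbb Z}=\bigcup_{\theta\in\mathbb Z}\mathcal D_\theta$, and for $P\in\mathcal D_{\mathbb Z}$, $M(P)=\{\theta\in\mathbb Z:P\in\mathcal D_\theta\}$ is the set of modes of $P$. The observations $X_1,X_2,\dots$ are i.i.d. with distribution $P$. Random sets $\mathrm{CI}_n=\mathrm{CI}_n(X_1,\dots,X_n)\subseteq\mathbb Z$ form a weak $(1-\alpha)$-confidence sequence for mode if for all $P\in\mathcal D_{\mathbb Z}$ and all $\theta\in M(P)$, $P(\forall n,\ \theta\in\mathrm{CI}_n)\ge1-\alpha$; they form a strong $(1-\alpha)$-confidence sequence for mode if for all $P\in\mathcal D_{\mathbb Z}$, $P(\forall n,\ M(P)\subseteq\mathrm{CI}_n)\ge1-\alpha$. For $A\subseteq\mathbb Z$, $\overline A$ is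 the convex hull of $A$ in $\mathbb Z$ (e.g. $\overline{\{1,3\}}=\{1,2,3\}$). For a probability measure $R$ on $\mathbb Z$ and an integer $m\ge0$ define, for $x\in\mathbb Z$, $$E^{R,m}(x)=1+\lambda_{R,m}\big(-\mathbf 1_{\{x=m\}}+\mathbf 1_{\{x=m+1\}}\big),\qquad \lambda_{R,m}=\frac{(f_R(m+1)-f_R(m))^+}{2(f_R(m)+f_R(m+1))},\quad 0/0:=0.$$ Let $\hat Q^{+,\theta}_k$ and $\hat Q^{-,\theta}_k$ be the empirical measures of $X_1-\theta,\dots,X_k-\theta$ and of $\theta-X_1,\dots,\theta-X_k$ respectively ($k\ge1$), and for $k=0$ interpret $E^{\hat Q^{\pm,\theta}_0,m}\equiv1$. Define $$J_n^{m+}(\theta)=\prod_{k=1}^nE^{\hat Q^{+,\theta}_{k-1},m}(X_k-\theta),\quad J_n^{m-}(\theta)=\prod_{k=1}^nE^{\hat Q^{-,\theta}_{k-1},m}(\theta-X_k),\quad J_n(\theta)=\sum_{m=0}^\infty2^{-m-2}\big(J_n^{m+}(\theta)+J_n^{m-}(\theta)\big).$$ *)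

(* Defs.v *)
From HB Require Import structures.
From mathcomp Require Import all_boot all_order all_algebra.
From mathcomp Require Import all_classical all_reals all_analysis.

Set Implicit Arguments.
Unset Strict Implicit.
Unset Printing Implicit Defensive.

Import Order.TTheory GRing.Theory Num.Theory.

Local Open Scope classical_set_scope.
Local Open Scope ring_scope.

HB.instance Definition _ := isPointed.Build int 0.

(* [int] gets its power-set sigma-algebra, as the library does for [nat]. *)
HB.instance Definition _ := @isMeasurable.Build default_measure_display
  int discrete_measurable discrete_measurable0
  discrete_measurableC discrete_measurableU.

Definition mass (R : realType) (P : set int -> \bar R) (n : int) : R :=
  fine (P [set n]).

Definition unimodal_at (R : realType) (theta : int) :
    set (probability int R) :=
  [set P | forall n : int,
    (n <= theta -> mass P (n - 1) <= mass P n) /\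
    (theta <= n -> mass P (n + 1) <= mass P n)].

Definition unimodal (R : realType) : set (probability int R) :=
  \bigcup_(theta in [set: int]) unimodal_at theta.

Definition modes (R : realType) (P : probability int R) : set int :=
  [set theta | unimodal_at theta P].

(* The product rule over every finite subfamily of events {X_i \in B_i}. *)
Definition mutually_independent d (T : measurableType d) (R : realType)
    (Pr : probability T R) (X : nat -> {RV Pr >-> int}) : Prop :=
  forall (s : seq nat) (B : nat -> set int), uniq s ->
    Pr (\bigcap_(i in [set` s]) (X i @^-1` B i)) =
    (\prod_(i <- s) Pr (X i @^-1` B i))%E.

(* The observations X_1, X_2, ... are X 0, X 1, ... *)
Definition iid d (T : measurableType d) (R : realType)
    (Pr : probability T R) (X : nat -> {RV Pr >-> int})
    (P : probability int R) : Prop :=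
  mutually_independent X /\
  forall (i : nat) (B : set int), distribution Pr (X i) B = P B.

Definition sample d (T : measurableType d) (R : realType)
    (Pr : probability T R) (X : nat -> {RV Pr >-> int}) (n : nat) (w : T) :
    n.-tuple int :=
  [tuple X i w | i < n].

(* [CI n x] is the set computed from the first n observations x.  The events
   below depend on countably many integer-valued random variables through
   finite prefixes only, hence are always measurable. *)
Definition weak_confidence_sequence (R : realType) (alpha : R)
    (CI : forall n : nat, n.-tuple int -> set int) : Prop :=
  forall (d : measure_display) (T : measurableType d) (Pr : probability T R)
    (X : nat -> {RV Pr >-> int}) (P : probability int R),
    unimodal P -> iid X P ->
    forall theta : int, modes P theta ->
    ((1 - alpha)%:E <=
      Pr [set w | forall n : nat, (1 <= n)%N ->
                    CI n (sample X n w) theta])%E.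

Definition strong_confidence_sequence (R : realType) (alpha : R)
    (CI : forall n : nat, n.-tuple int -> set int) : Prop :=
  forall (d : measure_display) (T : measurableType d) (Pr : probability T R)
    (X : nat -> {RV Pr >-> int}) (P : probability int R),
    unimodal P -> iid X P ->
    ((1 - alpha)%:E <=
      Pr [set w | forall n : nat, (1 <= n)%N ->
                    (modes P `<=` CI n (sample X n w))%classic])%E.

(* The convex hull in the integers: the smallest order-convex superset. *)
Definition zhull (A : set int) : set int := smallest (@is_interval int) A.

(* On the empty sample this is the null measure, see [evalue_empirical_nil]. *)
Definition empirical (R : realType) (s : seq int) :
    {measure set int -> \bar R} :=
  mscale ((size s)%:R^-1)%:nng (msum (fun i => \d_(nth 0 s i)) (size s)).

(* The convention 0 / 0 = 0 is the library's. *)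
Definition tilt (R : realType) (Q : set int -> \bar R) (m : nat) : R :=
  Num.max (mass Q m.+1%:Z - mass Q m%:Z) 0 /
  (2 * (mass Q m%:Z + mass Q m.+1%:Z)).

Definition evalue (R : realType) (Q : set int -> \bar R) (m : nat)
    (x : int) : R :=
  1 + tilt Q m * (- \1_[set m%:Z] x + \1_[set m.+1%:Z] x).

Lemma mass_empirical (R : realType) (s : seq int) (n : int) :
  mass (empirical R s) n = (count_mem n s)%:R / (size s)%:R.
Proof.
rewrite /mass /empirical /= /mscale /= /msum /dirac /=.
rewrite sumEFin -EFinM /= mulrC -sum1_count natr_sum (big_nth 0) big_mkord.
rewrite [in RHS]big_mkcond /=; congr (_ / _); apply: eq_bigr => i _.
rewrite indicE; case: eqP => [->|sn]; first by rewrite mem_set.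
by rewrite memNset.
Qed.

Lemma evalue_empirical_nil (R : realType) (m : nat) (x : int) :
  evalue (empirical R [::]) m x = 1.
Proof.
by rewrite /evalue /tilt !mass_empirical /= !mul0r addr0 mulr0 invr0 mulr0
  mul0r addr0.
Qed.

(* The factor of index k : 'I_n uses the k observations preceding y_k. *)
Definition eprocess (R : realType) (m n : nat) (y : n.-tuple int) : R :=
  \prod_(k < n) evalue (empirical R (take k y)) m (tnth y k).

Definition Jplus (R : realType) (m n : nat) (theta : int)
    (x : n.-tuple int) : R :=
  eprocess R m [tuple tnth x i - theta | i < n].

Definition Jminus (R : realType) (m n : nat) (theta : int)
    (x : n.-tuple int) : R :=
  eprocess R m [tuple theta - tnth x i | i < n].

Definition J (R : realType) (n : nat) (theta : int) (x : n.-tuple int) :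
    \bar R :=
  (\sum_(0 <= m <oo)
     (2 ^- m.+2 * (Jplus R m theta x + Jminus R m theta x))%:E)%E.

Definition mode_CI (R : realType) (alpha : R) (n : nat) (x : n.-tuple int) :
    set int :=
  [set theta | (J R theta x <= (alpha^-1)%:E)%E].

(* Main.v *)
(** At a mode [theta] the masses decrease away from [theta], so each factor
[evalue], whose tilt is predictable and nonnegative, has expectation at most 1
under the true law: [J] is a nonnegative supermartingale with initial value at
most 1 and Ville's inequality bounds the probability that it ever exceeds
[1 / alpha].  A law on the integers has finitely many modes, all lying between
a least and a greatest one, so covering these two at level [alpha / 2] each
covers all modes by the convex hull. *)

Require Import Defs.
From mathcomp Require Import all_boot all_order all_algebra.
From mathcomp Require Import all_classical all_reals all_analysis.
From mathcomp Require Import zify ring lra.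

Set Implicit Arguments.
Unset Strict Implicit.
Unset Printing Implicit Defensive.

Import Order.TTheory GRing.Theory Num.Theory.

Local Open Scope classical_set_scope.
Local Open Scope ring_scope.

(** * Prefixes of the observations and the events they determine *)

Definition past {T : Type} (X : nat -> T -> int) (n : nat) (w : T) : seq int :=
  mkseq (X ^~ w) n.

Definition cylinder {T : Type} (X : nat -> T -> int) (s : seq int) : set T :=
  [set w | past X (size s) w = s].

Lemma cylinder_rcons {T : Type} (X : nat -> T -> int) (s : seq int) (y : int) :
  cylinder X (rcons s y) = cylinder X s `&` X (size s) @^-1` [set y].
Proof.
apply/seteqP; rewrite /cylinder /past; split => w /=; rewrite size_rcons mkseqS.
  by move/rcons_inj => [-> ->].
by move=> [-> ->].
Qed.

(** This is the shape to which [mutually_independent] applies, with the duplicate-free index list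
    [iota 0 (size s)]. *)
Lemma cylinder_bigcap {T : Type} (X : nat -> T -> int) (s : seq int) :
  cylinder X s =
  \bigcap_(i in [set` iota 0 (size s)]) (X i @^-1` [set nth 0 s i]).
Proof.
apply/seteqP; split => w /=.
  move=> ws i /=; rewrite mem_iota /= => si.
  by rewrite -[in RHS]ws nth_mkseq.
move=> ws; apply: (@eq_from_nth _ 0); rewrite size_mkseq// => i si.
by rewrite nth_mkseq// ws//= mem_iota.
Qed.

Lemma measurable_cylinder d (T : measurableType d) (R : realType)
    (Pr : probability T R) (X : nat -> {RV Pr >-> int}) (s : seq int) :
  measurable (cylinder X s).
Proof.
rewrite cylinder_bigcap; apply: bigcap_measurableType => i _.
by rewrite -[X in measurable X]setTI; exact: measurable_funP.
Qed.

(** Finite integer sequences are countable, so the event is a countable union of cylinders whatever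
    [B] is. *)
Lemma measurable_past d (T : measurableType d) (R : realType)
    (Pr : probability T R) (X : nat -> {RV Pr >-> int}) (n : nat)
    (B : set (seq int)) :
  measurable [set w | B (past X n w)].
Proof.
have -> : [set w | B (past X n w)] =
    \bigcup_s (if `[< B s >] && (size s == n) then cylinder X s else set0).
  apply/seteqP; split => [w /= Bw|w [s _]].
    exists (past X n w) => //; rewrite asboolT//= size_mkseq eqxx.
    by rewrite /cylinder /= size_mkseq.
  case: ifPn => // /andP[/asboolP Bs /eqP <-].
  by rewrite /cylinder /= => ->.
apply: countable_bigcupT_measurable; first exact: countableP.
by move=> s; case: ifP => _ //; exact: measurable_cylinder.
Qed.

(** Splits the integers into singletons indexed by [nat], as countable additivity requires; fibres
    over non-codes are empty. *)
Lemma pickle_fiber (i : nat) :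
  pickle @^-1` [set i] = set0 :> set int \/
  exists y : int, pickle @^-1` [set i] = [set y].
Proof.
have [[y yi]|yi] := pselect (exists y : int, pickle y = i).
  right; exists y; apply/seteqP; split => z /=; rewrite -yi; last by move=> ->.
  exact: (pcan_inj pickleK).
by left; apply/seteqP; split => // y /= ?; case: yi; exists y.
Qed.

(** The only form in which Ville's inequality uses the i.i.d. hypothesis: given the prefix, the next
    observation has law [P]. *)
Lemma iid_cylinder_rcons d (T : measurableType d) (R : realType)
    (Pr : probability T R) (X : nat -> {RV Pr >-> int})
    (P : probability int R) (s : seq int) (y : int) :
  iid X P ->
  Pr (cylinder X (rcons s y)) = (Pr (cylinder X s) * P [set y])%E.
Proof.
move=> [indep law]; rewrite !cylinder_bigcap !indep ?iota_uniq//.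
rewrite size_rcons -[X in iota 0 X]addn1 iotaD big_cat/= big_seq1.
rewrite nth_rcons ltnn eqxx; congr (_ * _)%E; last exact: law.
apply: eq_big_seq => i; rewrite mem_iota /= => si.
by rewrite nth_rcons si.
Qed.

Lemma integral_set1_discrete (R : realType) (P : probability int R)
    (f : int -> \bar R) (y : int) :
  (\int[P]_(x in [set y]) f x = f y * P [set y])%E.
Proof.
rewrite -[RHS](integral_cst P (D := [set y]))//.
by apply: eq_integral => x; rewrite inE => ->.
Qed.

(** * Ville's inequality for processes that depend on the observed prefix *)

Definition exceeds {T : Type} (R : realType) (X : nat -> T -> int)
    (J : seq int -> \bar R) (c : \bar R) (n N : nat) : set T :=
  [set w | exists2 k, (n <= k <= n + N)%N & (c < J (past X k w))%E].

Lemma measurable_exceeds d (T : measurableType d) (R : realType)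
    (Pr : probability T R) (X : nat -> {RV Pr >-> int})
    (J : seq int -> \bar R) (c : \bar R) (n N : nat) :
  measurable (exceeds X J c n N).
Proof.
have -> : exceeds X J c n N =
    \bigcup_(k in [set k | (n <= k <= n + N)%N])
      [set w | [set s | (c < J s)%E] (past X k w)].
  by apply/seteqP; split => w /= [k]; exists k.
by apply: bigcup_measurable => k _; exact: measurable_past.
Qed.

(* Ville's inequality conditionally on an observed prefix [s]: by induction on
   the horizon [N] only the next observation is averaged, so that conditional
   expectations are plain integrals against [P]. *)
Lemma ville_horizon d (T : measurableType d) (R : realType)
    (Pr : probability T R) (X : nat -> {RV Pr >-> int})
    (P : probability int R) (J : seq int -> \bar R) (c : R) (N : nat)
    (s : seq int) :
  iid X P -> 0 <= c -> (forall s, 0 <= J s)%E ->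
  (forall s, \int[P]_y J (rcons s y) <= J s)%E ->
  (c%:E * Pr (cylinder X s `&` exceeds X J c%:E (size s) N) <=
   Pr (cylinder X s) * J s)%E.
Proof.
move=> XP c0 J0 Jsup.
have mE t N' : measurable (cylinder X t `&` exceeds X J c%:E (size t) N').
  by apply: measurableI; [exact: measurable_cylinder|exact: measurable_exceeds].
(* Once [J] is above [c] at the prefix itself, bounding the event by the whole cylinder suffices. *)
have above t N' : (c%:E < J t)%E ->
    (c%:E * Pr (cylinder X t `&` exceeds X J c%:E (size t) N') <=
      Pr (cylinder X t) * J t)%E.
  move=> cJ; rewrite muleC; apply: lee_pmul => //.
  - apply: le_measure; rewrite ?inE//; exact: measurable_cylinder.
  - exact: ltW.
elim: N s => [|N IH] s; have [cJ|Jc] := ltP c%:E (J s); try exact: above.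
  (* With horizon 0 the only admissible time is [size s], where [J s <= c] forbids a crossing. *)
  suff -> : cylinder X s `&` exceeds X J c%:E (size s) 0 = set0.
    by rewrite measure0 mule0 mule_ge0.
  apply/seteqP; split => // w [ws [k]].
  by rewrite addn0 -eqn_leq => /eqP <-; rewrite ws ltNge Jc.
pose F (i : nat) : set int := pickle @^-1` [set i].
(* The crossing event is split by the value of the next observation. Since [J s <= c], the time
   window may start one step later, which leaves horizon [N]. *)
pose G (i : nat) := (cylinder X s `&` exceeds X J c%:E (size s).+1 N) `&`
  (X (size s) @^-1` F i).
have mG i : measurable (G i).
  apply: measurableI; first by apply: measurableI;
    [exact: measurable_cylinder|exact: measurable_exceeds].
  by rewrite -[X in measurable X]setTI; exact: measurable_funP.
set p := Pr (cylinder X s).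
have p0 : (0 <= p)%E by exact: measure_ge0.
apply: (@le_trans _ _ (c%:E * \sum_(0 <= i <oo) Pr (G i))%E).
  apply: lee_wpmul2l; first by rewrite lee_fin.
  apply: measure_sigma_subadditive => //.
  move=> w [ws [k /andP[nk kn] ck]]; exists (pickle (X (size s) w)) => //.
  split; split => //=; exists k => //.
  rewrite addSnnS kn andbT ltn_neqAle nk andbT.
  by apply/eqP => nk'; move: ck; rewrite -nk' ws ltNge Jc.
rewrite -nneseriesZl//.
apply: (@le_trans _ _
    (\sum_(0 <= i <oo) \int[P]_(y in F i) (p * J (rcons s y)))%E).
  apply: lee_nneseries => [i _ _|i _]; first by rewrite mule_ge0.
  have [Fi|[y Fi]] := pickle_fiber i; rewrite /G /F Fi.
    by rewrite preimage_set0 setI0 measure0 mule0 integral_set0.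
  have -> : cylinder X s `&` exceeds X J c%:E (size s).+1 N `&`
        X (size s) @^-1` [set y] =
      cylinder X (rcons s y) `&` exceeds X J c%:E (size (rcons s y)) N.
    by rewrite size_rcons cylinder_rcons setIAC.
  apply: (le_trans (IH _)).
  by rewrite (iid_cylinder_rcons _ _ XP) integral_set1_discrete -/p muleAC.
(* The fibres reassemble into one integral over all integers, to which the supermartingale
   hypothesis applies. *)
rewrite -ge0_integral_bigcup//; last 2 first.
- by move=> y _; rewrite mule_ge0.
- exact: trivIset_preimage1.
have -> : \bigcup_i F i = setT.
  by apply/seteqP; split => // y _; exists (pickle y).
rewrite ge0_integralZl//.
by apply: lee_wpmul2l.
Qed.

(** Starts from the empty prefix and lets the horizon tend to infinity, by continuity from below. *)
Lemma ville d (T : measurableType d) (R : realType)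
    (Pr : probability T R) (X : nat -> {RV Pr >-> int})
    (P : probability int R) (J : seq int -> \bar R) (c : R) :
  iid X P -> 0 <= c -> (forall s, 0 <= J s)%E ->
  (forall s, \int[P]_y J (rcons s y) <= J s)%E ->
  (c%:E * Pr [set w | exists k, (c%:E < J (past X k w))%E] <= J [::])%E.
Proof.
move=> XP c0 J0 Jsup.
pose F N := exceeds X J c%:E 0 N.
have -> : [set w | exists k, (c%:E < J (past X k w))%E] = \bigcup_N F N.
  apply/seteqP; split => w /=.
    by move=> [k ck]; exists k => //; exists k; rewrite /= ?leqnn.
  by move=> [N _ [k _ ck]]; exists k.
have mF N : measurable (F N) by exact: measurable_exceeds.
have FN N : (c%:E * Pr (F N) <= J [::])%E.
  have := @ville_horizon _ _ _ _ _ _ _ _ N [::] XP c0 J0 Jsup.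
  suff -> : cylinder X [::] = setT by rewrite setTI probability_setT mul1e.
  by apply/seteqP; split.
have cvF : (fun N => c%:E * Pr (F N))%E @ \oo --> (c%:E * Pr (\bigcup_N F N))%E.
  apply: cvgeZl => //; apply: nondecreasing_cvg_mu => //.
    exact: bigcup_measurable.
  move=> n m nm; apply/subsetPset => w [k kn ck]; exists k => //.
  by move: kn; rewrite !add0n /= => /leq_trans ->.
rewrite -(cvg_lim _ cvF)//; apply: lime_le.
  by apply/cvg_ex; eexists; exact: cvF.
exact: nearW.
Qed.

(** * Nonnegativity and expectation of a single factor *)

Lemma tilt_itv (R : realType) (Q : {measure set int -> \bar R}) (m : nat) :
  0 <= tilt Q m <= 1.
Proof.
rewrite /tilt; set a := mass Q m%:Z; set b := mass Q m.+1%:Z.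
have a0 : 0 <= a by exact: fine_ge0.
have b0 : 0 <= b by exact: fine_ge0.
have [ab|ab] := eqVneq (a + b) 0.
  by rewrite ab mulr0 invr0 mulr0 lexx ler01.
have ab0 : 0 < a + b by rewrite lt0r ab addr_ge0.
apply/andP; split.
  by rewrite divr_ge0 ?le_max ?lexx ?orbT// mulr_ge0 ?ltW.
rewrite ler_pdivrMr ?mulr_gt0// mul1r ge_max; apply/andP; split; lra.
Qed.

Lemma evalue_ge0 (R : realType) (Q : {measure set int -> \bar R}) (m : nat)
    (x : int) :
  0 <= evalue Q m x.
Proof.
have /andP[t0 t1] := tilt_itv Q m; rewrite /evalue !indicE.
by case: (_ \in _); case: (_ \in _) => /=; lra.
Qed.

(** The expectation is 1 plus the nonnegative tilt times a difference of probabilities that is at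
    most 0. The map [g] stands for the shift or the reflection at [theta]. *)
Lemma integral_evalue_le1 (R : realType) (P : probability int R)
    (Q : {measure set int -> \bar R}) (m : nat) (g : int -> int) :
  (P (g @^-1` [set m.+1%:Z]) <= P (g @^-1` [set m%:Z]))%E ->
  (\int[P]_y (evalue Q m (g y))%:E <= 1)%E.
Proof.
move=> Pm; have /andP[t0 t1] := tilt_itv Q m.
set A := g @^-1` [set m%:Z] in Pm *; set B := g @^-1` [set m.+1%:Z] in Pm *.
set t := tilt Q m in t0 t1 *.
have tint C : (\int[P]_y (t * \1_C y)%:E = t%:E * P C)%E.
  under eq_integral do rewrite EFinM.
  rewrite ge0_integralZl// ?integral_indic ?setIT//.
have t1_ge0 C (y : int) : (0 <= (t * \1_C y)%:E)%E by rewrite lee_fin mulr_ge0.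
(* The negative term is moved to the other side, so that only nonnegative functions are integrated;
   it is finite and is cancelled afterwards. *)
have : (\int[P]_y (evalue Q m (g y))%:E + t%:E * P A = 1 + t%:E * P B)%E.
  rewrite -!tint -(probability_setT P) -[X in (_ = X + _)%E]mul1e.
  rewrite -integral_cst// -!ge0_integralD//.
  - apply: eq_integral => y _; rewrite /= -!EFinD; congr (_%:E).
    rewrite /evalue -/t -[\1_A y]/(\1_[set m%:Z] (g y)).
    rewrite -[\1_B y]/(\1_[set m.+1%:Z] (g y)); ring.
  - by move=> y _; rewrite lee_fin evalue_ge0.
move=> eq1.
rewrite -(@leeD2rE _ (t%:E * P A)%E)//; last first.
  by rewrite fin_numM// fin_num_measure.
by rewrite eq1; apply: leeD2l; apply: lee_wpmul2l; rewrite // lee_fin.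
Qed.

(** * The process [J] on finite sequences and its supermartingale property *)

Definition eproc (R : realType) (m : nat) (s : seq int) : R :=
  \prod_(0 <= k < size s) evalue (empirical R (take k s)) m (nth 0 s k).

Lemma eproc_ge0 (R : realType) (m : nat) (s : seq int) : 0 <= eproc R m s.
Proof. by apply: prodr_ge0 => k _; exact: evalue_ge0. Qed.

(** Predictability: the tilt of the new factor is computed from [s] alone. *)
Lemma eproc_rcons (R : realType) (m : nat) (s : seq int) (y : int) :
  eproc R m (rcons s y) = eproc R m s * evalue (empirical R s) m y.
Proof.
rewrite /eproc size_rcons big_nat_recr//= -cats1 take_size_cat//.
rewrite nth_cat ltnn subnn; congr (_ * _).
apply: eq_big_nat => k /andP[_ ks].
by rewrite takel_cat ?(ltnW ks)// nth_cat ks.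
Qed.

Lemma eprocessE (R : realType) (m n : nat) (y : n.-tuple int) :
  eprocess R m y = eproc R m y.
Proof.
rewrite /eproc size_tuple big_mkord; apply: eq_bigr => k _.
by rewrite (tnth_nth 0).
Qed.

Definition Jterm (R : realType) (theta : int) (m : nat) (s : seq int) : R :=
  2 ^- m.+2 * (eproc R m [seq x - theta | x <- s] +
               eproc R m [seq theta - x | x <- s]).

Definition Jseq (R : realType) (theta : int) (s : seq int) : \bar R :=
  (\sum_(0 <= m <oo) (Jterm R theta m s)%:E)%E.

Lemma JE (R : realType) (theta : int) (n : nat) (x : n.-tuple int) :
  J R theta x = Jseq R theta x.
Proof.
apply: eq_eseriesr => m _; rewrite /Jterm /Jplus /Jminus !eprocessE /=.
have tupleE (f : int -> int) : [seq f (tnth x i) | i <- enum 'I_n] = map f x.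
  by rewrite -[in RHS](map_tnth_enum x) -map_comp.
by rewrite (tupleE (fun x => x - theta)) (tupleE (fun x => theta - x)).
Qed.

Lemma Jterm_ge0 (R : realType) (theta : int) (m : nat) (s : seq int) :
  0 <= Jterm R theta m s.
Proof. by rewrite mulr_ge0 ?invr_ge0 ?exprn_ge0// addr_ge0 ?eproc_ge0. Qed.

Lemma Jseq_ge0 (R : realType) (theta : int) (s : seq int) :
  (0 <= Jseq R theta s)%E.
Proof. by apply: nneseries_ge0 => m _ _; rewrite lee_fin Jterm_ge0. Qed.

(** Both products are empty, so the term of index [m] is [2 ^- m.+1] and the series is geometric. *)
Lemma Jseq_nil (R : realType) (theta : int) : (Jseq R theta [::] <= 1)%E.
Proof.
apply: le_trans (@epsilon_trick0 R 1 xpredT ler01).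
apply: lee_nneseries => [m _ _|m _]; first by rewrite lee_fin Jterm_ge0.
rewrite lee_fin /Jterm /eproc !big_geq// natrX (_ : 1 + 1 = 2)//.
by rewrite exprS invfM mulrAC mulVf// lexx.
Qed.

Lemma mass_le_probability (R : realType) (P : probability int R) (a b : int) :
  mass P a <= mass P b -> (P [set a] <= P [set b])%E.
Proof.
move=> ab; rewrite -[leLHS]fineK ?fin_num_measure//.
by rewrite -[leRHS]fineK ?fin_num_measure.
Qed.

(** Given [s], the past products are constants, and each of the two new factors has mean at most 1:
    the masses decrease from [theta] to the right for one and to the left for the other. *)
Lemma integral_Jterm (R : realType) (P : probability int R) (theta : int)
    (m : nat) (s : seq int) :
  unimodal_at theta P ->
  (\int[P]_y (Jterm R theta m (rcons s y))%:E <= (Jterm R theta m s)%:E)%E.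
Proof.
move=> Ptheta.
rewrite /Jterm.
set a := eproc R m [seq x - theta | x <- s].
set b := eproc R m [seq theta - x | x <- s].
set Ea := evalue (empirical R [seq x - theta | x <- s]) m.
set Eb := evalue (empirical R [seq theta - x | x <- s]) m.
have w0 : 0 <= 2 ^- m.+2 :> R by rewrite invr_ge0 exprn_ge0.
under eq_integral do rewrite !map_rcons !eproc_rcons EFinM EFinD !EFinM.
rewrite ge0_integralZl//; last first.
  move=> y _; rewrite -!EFinM -EFinD lee_fin.
  by rewrite addr_ge0 ?mulr_ge0 ?eproc_ge0 ?evalue_ge0.
rewrite EFinM; apply: lee_wpmul2l; first by rewrite lee_fin.
rewrite ge0_integralD//; last 2 first.
- by move=> y _; rewrite -EFinM lee_fin mulr_ge0 ?eproc_ge0 ?evalue_ge0.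
- by move=> y _; rewrite -EFinM lee_fin mulr_ge0 ?eproc_ge0 ?evalue_ge0.
have scaled c Q g : 0 <= c ->
    (P (g @^-1` [set m.+1%:Z]) <= P (g @^-1` [set m%:Z]))%E ->
    (\int[P]_y (c%:E * (evalue (empirical R Q) m (g y))%:E) <= c%:E)%E.
  move=> c0 gP; rewrite ge0_integralZl//.
  - rewrite -[leRHS]mule1; apply: lee_wpmul2l; first by rewrite lee_fin.
    exact: integral_evalue_le1.
  - by move=> y _; rewrite lee_fin evalue_ge0.
have preim (g : int -> int) g' : cancel g g' -> cancel g' g ->
    forall k, g @^-1` [set k] = [set g' k].
  move=> gK g'K k; apply/seteqP; split => y /=; first by move=> <-.
  by move=> ->.
rewrite EFinD; apply: leeD; apply: scaled; rewrite ?eproc_ge0//.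
(* Right side: unimodality at [m + theta] compares it with its right neighbour. *)
- rewrite !(preim _ (fun x => x + theta));
    try by move=> x; rewrite ?addrK ?subrK.
  apply: mass_le_probability.
  have [_] := Ptheta (m%:Z + theta).
  rewrite (_ : _ + 1 = m.+1%:Z + theta); last by lia.
  by apply; lia.
(* Left side: unimodality at [theta - m] compares it with its left neighbour. *)
- rewrite !(preim _ (fun x => theta - x)); try by move=> x; rewrite subKr.
  apply: mass_le_probability.
  have [+ _] := Ptheta (theta - m%:Z).
  rewrite (_ : _ - 1 = theta - m.+1%:Z); last by lia.
  by apply; lia.
Qed.

Lemma integral_Jseq (R : realType) (P : probability int R) (theta : int)
    (s : seq int) :
  unimodal_at theta P ->
  (\int[P]_y Jseq R theta (rcons s y) <= Jseq R theta s)%E.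
Proof.
move=> Ptheta; rewrite integral_nneseries//; last first.
  by move=> m y _; rewrite lee_fin Jterm_ge0.
apply: lee_nneseries => [m _ _|m _]; last exact: integral_Jterm.
by apply: integral_ge0 => y _; rewrite lee_fin Jterm_ge0.
Qed.

(** * Coverage of a single mode *)

Definition miss {T : Type} (R : realType) (X : nat -> T -> int) (alpha : R)
    (theta : int) : set T :=
  [set w | exists n, ((alpha^-1)%:E < Jseq R theta (past X n w))%E].

Lemma measurable_miss d (T : measurableType d) (R : realType)
    (Pr : probability T R) (X : nat -> {RV Pr >-> int}) (alpha : R)
    (theta : int) :
  measurable (miss X alpha theta).
Proof.
have -> : miss X alpha theta = \bigcup_n [set w |
    [set s | ((alpha^-1)%:E < Jseq R theta s)%E] (past X n w)].
  by apply/seteqP; split => w /= [n]; exists n.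
by apply: bigcup_measurable => n _; exact: measurable_past.
Qed.

Lemma probability_miss d (T : measurableType d) (R : realType)
    (Pr : probability T R) (X : nat -> {RV Pr >-> int})
    (P : probability int R) (alpha : R) (theta : int) :
  0 < alpha -> iid X P -> modes P theta ->
  (Pr (miss X alpha theta) <= alpha%:E)%E.
Proof.
move=> alpha0 XP Ptheta.
have alphaV0 : 0 <= alpha^-1 by rewrite invr_ge0 ltW.
have := ville XP alphaV0 (Jseq_ge0 R theta)
  (fun s => integral_Jseq s Ptheta).
move=> /le_trans/(_ (Jseq_nil _ _)); rewrite -/(miss X alpha theta) => le1.
rewrite -[leLHS]mul1e -(divff (lt0r_neq0 alpha0)) EFinM -muleA -[leRHS]mule1.
by apply: lee_wpmul2l => //; rewrite lee_fin ltW.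
Qed.

Lemma sampleE d (T : measurableType d) (R : realType)
    (Pr : probability T R) (X : nat -> {RV Pr >-> int}) (n : nat) (w : T) :
  sample X n w = past X n w :> seq int.
Proof. by rewrite /= /past /mkseq -val_enum_ord -map_comp. Qed.

Lemma mode_CIE d (T : measurableType d) (R : realType)
    (Pr : probability T R) (X : nat -> {RV Pr >-> int}) (alpha : R)
    (n : nat) (w : T) (theta : int) :
  mode_CI alpha (sample X n w) theta <->
  (Jseq R theta (past X n w) <= (alpha^-1)%:E)%E.
Proof. by rewrite /mode_CI /= JE sampleE. Qed.

Lemma missC d (T : measurableType d) (R : realType)
    (Pr : probability T R) (X : nat -> {RV Pr >-> int}) (alpha : R)
    (theta : int) :
  0 < alpha < 1 ->
  [set w | forall n, (1 <= n)%N -> mode_CI alpha (sample X n w) theta] =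
  ~` miss X alpha theta.
Proof.
move=> /andP[alpha0 alpha1]; apply/seteqP; split => w /=.
  (* [miss] also allows [n = 0], where the confidence sets impose nothing; there [J] is at most 1,
     hence at most [alpha^-1]. *)
  move=> CI [[|n]]; apply/negP; rewrite -leNgt; last exact/mode_CIE/CI.
  by rewrite (le_trans (Jseq_nil _ _))// lee_fin invf_ge1// ltW.
move=> nmiss n _; apply/mode_CIE; rewrite leNgt; apply/negP => Jn.
by apply: nmiss; exists n.
Qed.

(** * The least and the greatest mode *)

(** Induction on the distance to [theta], in both directions. It follows that all modes have the
    same mass. *)
Lemma unimodal_mass_max (R : realType) (P : probability int R)
    (theta k : int) :
  modes P theta -> mass P k <= mass P theta.
Proof.
move=> Ptheta; rewrite -[k](subrK theta) addrC.
elim/int_ind: (k - theta) => [|n IH|n IH]; first by rewrite addr0.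
  have [_] := Ptheta (theta + n).
  rewrite (_ : _ + 1 = theta + n.+1); last by lia.
  by move=> le_n; apply: le_trans IH; apply: le_n; lia.
have [+ _] := Ptheta (theta - n%:Z).
rewrite (_ : _ - 1 = theta - n.+1%:Z); last by lia.
by move=> le_n; apply: le_trans IH; apply: le_n; lia.
Qed.

(** Otherwise the maximal mass is 0, all singletons are null, and by countability so is the whole
    space. *)
Lemma mode_mass_gt0 (R : realType) (P : probability int R) (theta : int) :
  modes P theta -> 0 < mass P theta.
Proof.
move=> Ptheta; rewrite lt_neqAle fine_ge0// andbT eq_sym; apply/eqP => m0.
have P0 (k : int) : P [set k] = 0%E.
  rewrite -[LHS]fineK ?fin_num_measure//; congr (_%:E).
  by apply/eqP; rewrite eq_le fine_ge0// andbT -m0 unimodal_mass_max.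
suff : (P setT <= 0)%E by rewrite probability_setT lee_fin ler10.
pose F (i : nat) : set int := pickle @^-1` [set i].
apply: (@le_trans _ _ (\sum_(0 <= i <oo) P (F i))%E).
  by apply: measure_sigma_subadditive => // y _; exists (pickle y).
rewrite eseries0// => i _ _.
rewrite /F; have [->|[y ->]] := pickle_fiber i; first exact: measure0.
exact: P0.
Qed.

(** Two modes enclose a plateau: masses cannot decrease on the way up to the second mode, and the
    first already has the maximal mass. *)
Lemma modes_mass_eq (R : realType) (P : probability int R) (a : int)
    (N i : nat) :
  modes P a -> modes P (a + N%:Z) -> (i <= N)%N ->
  mass P (a + i%:Z) = mass P a.
Proof.
move=> Pa PN; elim: i => [|i IH] iN; first by rewrite addr0.
apply/eqP; rewrite eq_le unimodal_mass_max//= -IH; last exact: ltnW.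
have [+ _] := PN (a + i.+1%:Z); rewrite (_ : _ - 1 = a + i%:Z); last by lia.
by apply; lia.
Qed.

(** The [N] distinct points from [a] to [a + N - 1] all have the mass of [a], and the total mass is
    1. *)
Lemma modes_dist (R : realType) (P : probability int R) (a : int) (N : nat) :
  modes P a -> modes P (a + N%:Z) -> N%:R * mass P a <= 1.
Proof.
move=> Pa PN.
rewrite -lee_fin -(probability_setT P).
have tF : trivIset [set: nat] (fun i : nat => [set a + i%:Z]).
  by apply/trivIsetP => i j _ _ ij; apply/seteqP; split => // x /= [-> ?]; lia.
apply: (@le_trans _ _ (P (\bigcup_i [set a + i%:Z]))); last first.
  by apply: le_measure; rewrite ?inE.
rewrite measure_bigcup//; under eq_eseriesl do rewrite in_setT.
apply: le_trans (nneseries_lim_ge N _); last by [].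
rewrite (eq_big_nat _ _ (F2 := fun => (mass P a)%:E)).
  by rewrite sumEFin sumr_const_nat subn0 mulr_natl.
move=> i /andP[_ iN]; rewrite -(modes_mass_eq Pa PN (ltnW iN)).
by rewrite fineK// fin_num_measure.
Qed.

Lemma exists_int_max (A : set int) (a : int) (N : nat) :
  A a -> (forall n : nat, A (a + n%:Z) -> (n <= N)%N) ->
  exists2 b, A b & forall x, A x -> x <= b.
Proof.
move=> Aa AN.
have ex : exists n, `[< A (a + n%:Z) >].
  by exists 0%N; apply/asboolP; rewrite addr0.
have ub n : `[< A (a + n%:Z) >] -> (n <= N)%N by move/asboolP/AN.
have [n /asboolP An nmax] := ex_maxnP ex ub.
exists (a + n%:Z) => // x Ax; have [xa|ax] := leP x a; first by lia.
have := nmax `|x - a|%N; rewrite (_ : a + `|x - a|%N = x); last by lia.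
by move=> /(_ (asboolT Ax)); lia.
Qed.

Lemma modes_extrema (R : realType) (P : probability int R) :
  unimodal P ->
  exists a b, [/\ modes P a, modes P b & forall x, modes P x -> a <= x <= b].
Proof.
move=> [theta _ Ptheta].
have m0 := mode_mass_gt0 Ptheta.
have massE x : modes P x -> mass P x = mass P theta.
  by move=> Px; apply/eqP; rewrite eq_le !unimodal_mass_max.
(* Modes share one positive mass, so [modes_dist] bounds the distance between any two of them by its
   inverse. *)
pose N := Num.trunc (mass P theta)^-1.
have bound a n : modes P a -> modes P (a + n%:Z) -> (n <= N)%N.
  move=> Pa Pn; have := modes_dist Pa Pn.
  rewrite (massE _ Pa) -ler_pdivlMr// mul1r.
  by rewrite truncn_ge_nat// invr_ge0 ltW.
have [b Pb bmax] :=
  @exists_int_max _ theta N Ptheta (fun n => bound _ n Ptheta).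
(* The least mode is obtained as the opposite of the maximum of the negated set. *)
have [a Pa amin] : exists2 a, modes P (- a) & forall x, modes P (- x) -> x <= a.
  apply: (@exists_int_max [set x | modes P (- x)] (- theta) N) => /=.
    by rewrite opprK.
  move=> n Pn; apply: (bound (- (- theta + n%:Z))) => //.
  by rewrite (_ : _ + _ = theta)//; lia.
exists (- a), b; split => // x Px; rewrite bmax// andbT.
by rewrite lerNl; apply: amin; rewrite opprK.
Qed.

(** * Convex hulls and the two coverage statements *)

Lemma zhull_itv (A : set int) (a b x : int) :
  A a -> A b -> a <= x <= b -> zhull A x.
Proof. by move=> Aa Ab axb I [Iitv AI]; apply: (Iitv a b) => //; exact: AI. Qed.

Theorem corollary2p7 (R : realType) (alpha : R) :
  0 < alpha -> alpha < 1 ->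
  weak_confidence_sequence alpha (fun n x => mode_CI alpha x) /\
  strong_confidence_sequence alpha (fun n x => zhull (mode_CI (alpha / 2) x)).
Proof.
move=> alpha0 alpha1; split=> d T Pr X P Puni XP.
  move=> theta Ptheta; rewrite missC ?alpha0//.
  rewrite probability_setC; last exact: measurable_miss.
  by rewrite EFinB leeB// (probability_miss _ XP).
have [a [b [Pa Pb Pab]]] := modes_extrema Puni.
have a2 : 0 < alpha / 2 < 1 by apply/andP; split; lra.
have /andP[a20 _] := a2.
(* A union bound over the two extreme modes gives failure probability at most [alpha], however many
   modes lie between. *)
set M := miss X (alpha / 2) a `|` miss X (alpha / 2) b.
have mM : measurable M by apply: measurableU; exact: measurable_miss.
apply: (@le_trans _ _ (Pr (~` M))).
  rewrite probability_setC// EFinB leeB//.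
  apply: (le_trans (measureU2 _ _ _)); [exact: measurable_miss..|].
  rewrite [alpha](splitr alpha) EFinD -splitr.
  by apply: leeD; exact: (probability_miss a20 XP).
apply: le_measure; rewrite ?inE; first exact: measurableC.
  (* Monotonicity of the measure requires the strong coverage event to be measurable; it is a
     countable intersection of prefix events. *)
  pose B := [set s | modes P `<=`
    zhull [set theta | (Jseq R theta s <= ((alpha / 2)^-1)%:E)%E]].
  rewrite [X in measurable X](_ : _ =
      \bigcap_(n in [set n | (1 <= n)%N]) [set w | B (past X n w)]).
    by apply: bigcap_measurableType => n _; exact: measurable_past.
  have hullE n w : mode_CI (alpha / 2) (sample X n w) =
      [set theta | (Jseq R theta (past X n w) <= ((alpha / 2)^-1)%:E)%E].
    by apply/seteqP; split => theta /mode_CIE.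
  by apply/seteqP; split => w /= CI n n1; have := CI n n1; rewrite /B/= hullE.
(* Off [M] both extreme modes are in every confidence set, so the hull contains all modes. *)
rewrite /M setCU -!missC// => w [/= CIa CIb] n n1 x /Pab.
by apply: zhull_itv; [exact: CIa|exact: CIb].
Qed.
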